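(* Let $k\in\{3,4,5,6\}$, and let $G^2=\langle \mathbf r_0,\mathbf r_1,\mathbf r_2,\mathbf r_3\rangle^2$ be the subgroup of $GL(4,\mathbf F_4)$, $\mathbf F_4=\mathbf Z[\tau]/(2)$, generated by the reductions modulo $2$ of the matrices $\mathbf r_0,\mathbf r_1,\mathbf r_2,\mathbf r_3$ defined in the context. Then $G^2$ (with these four reduced matrices as distinguished generators) is a C-group that is isomorphic to the semidirect product $C_2^4\rtimes A_5$.
   Context: Let $\tau=\frac{1+\sqrt5}{2}$ and $\mathbf Z[\tau]=\{a+b\tau\mid a,b\in\mathbf Z\}$. The number $2$ is prime in $\mathbf Z[\tau]$ and $\mathbf Z[\tau]/(2)$ is the field $\mathbf F_4$ with four elements. For $k\in\{3,4,5,6\}$ put $\rho_3=1$, $\rho_4=2$, $\rho_5=\tau^2$, $\rho_6=3$, and define the matrices over $\mathbf Z[\tau]$ $$\mathbf r_0=\begin{bmatrix}-1&\tau^2&0&0\\0&1&0&0\\0&0&1&0\\0&0&0&1\end{bmatrix},\quad \mathbf r_1=\begin{bmatrix}1&0&0&0\\1&-1&1&\rho_k\\0&0&1&0\\0&0&0&1\end{bmatrix},$$ $$\mathbf r_2=\begin{bmatrix}1&0&0&0\\0&1&0&0\\0&1&-1&0\\0&0&0&1\end{bmatrix},\quad \mathbf r_3=\begin{bmatrix}1&0&0&0\\0&1&0&0\\0&0&1&0\\0&1&0&-1\end{bmatrix}.$$ The reduction of a matrix modulo $2$ is obtained by reducing every entry modulo the ideal $(2)$. A group $\Gamma$ generated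 by a set $S=\{s_0,\dots,s_{n-1}\}$ of $n$ involutions is called a C-group (with distinguished generating set $S$) if it satisfies the intersection condition $\langle s_i\mid i\in I\rangle\cap\langle s_j\mid j\in J\rangle=\langle s_k\mid k\in I\cap J\rangle$ for all subsets $I,J\subseteq\{0,1,\dots,n-1\}$. $C_2$ is the cyclic group of order $2$ and $A_5$ the alternating group of degree $5$. The group $C_2^4\rtimes A_5$ is a semidirect product of order $960$ with normal subgroup $C_2^4$ and complement $A_5$; the action is not specified, so the isomorphism is with such a semidirect product for some action of $A_5$ on $C_2^4$. *)

(* Defs.v *)
From HB Require Import structures.
From mathcomp Require Import all_boot all_order all_algebra all_fingroup.
From mathcomp Require Import all_solvable all_field ring_quotient.
From mathcomp Require Import zify ring.

Set Implicit Arguments.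
Unset Strict Implicit.
Unset Printing Implicit Defensive.

Import Order.TTheory GRing.Theory Num.Theory.
Local Open Scope ring_scope.

Definition tau_algC : algC := (1 + sqrtC 5) / 2.

Lemma tau_algC_sqr : tau_algC * tau_algC = tau_algC + 1.
Proof.
have s5 : sqrtC 5 * sqrtC 5 = 5 :> algC by rewrite -expr2 sqrtCK.
rewrite /tau_algC.
have -> : (1 + sqrtC 5) / 2 * ((1 + sqrtC 5) / 2)
  = (1 + 2 * sqrtC 5 + sqrtC 5 * sqrtC 5) / 4 :> algC by field.
by rewrite s5; field.
Qed.

(* [Cint_span s] is the decidable set of integer combinations of [s]; see
   [Ztau_predP] for the usual form. *)
Definition Ztau_pred : {pred algC} := Cint_span [:: 1; tau_algC].

Lemma Ztau_predP (x : algC) :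
  reflect (exists a b : int, x = a%:~R + b%:~R * tau_algC) (x \in Ztau_pred).
Proof.
apply: (iffP (Cint_spanP (in_tuple [:: 1; tau_algC]) x)) => [[c ->] | [a [b ->]]].
  exists (c 0), (c 1); rewrite !big_ord_recl big_ord0 /= addr0.
  by rewrite mulrzl; congr (_ + tau_algC *~ c _); apply: val_inj.
exists [ffun i : 'I_2 => if i == 0 then a else b].
by rewrite !big_ord_recl big_ord0 !ffunE /= addr0 mulrzl.
Qed.

Lemma Ztau_mulr_closed : mulr_closed Ztau_pred.
Proof.
split=> [|x y]; first by apply/Ztau_predP; exists 1, 0; rewrite mul0r addr0.
move=> /Ztau_predP[a [b ->]] /Ztau_predP[c [d ->]]; apply/Ztau_predP.
exists (a * c + b * d), (a * d + b * c + b * d).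
rewrite !rmorphD !rmorphM /=.
rewrite !mulrDl !mulrDr mulrACA tau_algC_sqr; ring.
Qed.

HB.instance Definition _ := GRing.isZmodClosed.Build algC Ztau_pred
  (Cint_span_zmod_closed [:: 1; tau_algC]).
HB.instance Definition _ := GRing.isMulClosed.Build algC Ztau_pred
  Ztau_mulr_closed.

Record Ztau := MkZtau { Ztau_val :> algC; Ztau_valP : Ztau_val \in Ztau_pred }.
HB.instance Definition _ := [isSub for Ztau_val].
HB.instance Definition _ := [Choice of Ztau by <:].
HB.instance Definition _ := [SubChoice_isSubComNzRing of Ztau by <:].

Lemma tau_proof : tau_algC \in Ztau_pred.
Proof. by apply/Ztau_predP; exists 0, 1; rewrite mul1r add0r. Qed.
Definition tau : Ztau := MkZtau tau_proof.

Lemma tau_sqr : tau * tau = tau + 1.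
Proof. by apply: val_inj; exact: tau_algC_sqr. Qed.

Lemma ZtauE (x : Ztau) : exists a b : int, x = a%:~R + b%:~R * tau.
Proof.
have /Ztau_predP[a [b e]] := Ztau_valP x; exists a, b.
apply: val_inj; rewrite rmorphD rmorphM !rmorph_int; exact: e.
Qed.

Lemma Ztau_val_2M (x : Ztau) : Ztau_val (2 * x) = 2 * Ztau_val x.
Proof. by rewrite -[LHS]/(val _) rmorphM rmorph_nat. Qed.

(* The principal ideal (2) of Z[tau], as a boolean predicate; see [ideal2P]. *)
Definition ideal2 : {pred Ztau} := [pred x : Ztau | val x / 2 \in Ztau_pred].

Lemma ideal2P (x : Ztau) : reflect (exists y : Ztau, x = 2 * y) (x \in ideal2).
Proof.
apply: (iffP idP) => [hx | [y ->]].
  exists (MkZtau hx); apply: val_inj.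
  by rewrite [RHS]Ztau_val_2M mulrC divfK ?pnatr_eq0.
by rewrite inE [X in X / 2]Ztau_val_2M mulrAC divff ?pnatr_eq0 // mul1r Ztau_valP.
Qed.

Lemma ideal2_closed : idealr_closed ideal2.
Proof.
split.
- by apply/ideal2P; exists 0; rewrite mulr0.
- apply/negP => h2; have /Ztau_predP[a [b e]] : 1 / 2 \in Ztau_pred := h2.
  have s5 : sqrtC 5 * sqrtC 5 = 5 :> algC by rewrite -expr2 sqrtCK.
  have e1 : (1 - 2 * a - b)%:~R = b%:~R * sqrtC 5 :> algC.
    have h : 1 = 2 * a%:~R + b%:~R * (1 + sqrtC 5) :> algC.
      transitivity (2 * (1 / 2) : algC); first by field.
      by rewrite e /tau_algC; field.
    rewrite !rmorphB rmorphM /= rmorph1.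
    transitivity (2 * a%:~R + b%:~R * (1 + sqrtC 5) - 2 * a%:~R - b%:~R : algC).
      by congr (_ - _ - _).
    ring.
  have e2 : ((1 - 2 * a - b) * (1 - 2 * a - b))%:~R = (5 * (b * b))%:~R :> algC.
    by rewrite rmorphM /= e1 mulrACA s5 !rmorphM /=; ring.
  by have := intr_inj e2; lia.
- move=> c x y /ideal2P[u ->] /ideal2P[v ->]; apply/ideal2P.
  by exists (c * u + v); rewrite mulrDr mulrCA.
Qed.

HB.instance Definition _ := isIdealr.Build Ztau ideal2 ideal2_closed.

Definition FF4 := {ideal_quot ideal2}.
HB.instance Definition _ := GRing.ComNzRing.on FF4.

Definition red2 : Ztau -> FF4 := \pi_FF4%qT.
HB.instance Definition _ := GRing.RMorphism.on red2.

Lemma red2_surj (x : FF4) : exists y : Ztau, red2 y = x.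
Proof. by exists (generic_quotient.repr x); exact: generic_quotient.reprK. Qed.

Lemma red2_eq (x y : Ztau) : (red2 x == red2 y) = (x - y \in ideal2).
Proof. by rewrite Quotient.idealrBE. Qed.

Lemma red2_2 : (2 : FF4) = 0.
Proof.
rewrite -(rmorph_nat red2) -(rmorph0 red2); apply/eqP; rewrite red2_eq.
by apply/ideal2P; exists 1; rewrite mulr1 subr0.
Qed.

Definition F4_enum : seq FF4 := [:: 0; 1; red2 tau; red2 tau + 1].

Lemma F4_addxx (x : FF4) : x + x = 0.
Proof. by rewrite -mulr2n -mulr_natl red2_2 mul0r. Qed.

Lemma F4_tau_sqr : red2 tau * red2 tau = red2 tau + 1.
Proof. by rewrite -rmorphM tau_sqr rmorphD rmorph1. Qed.

Lemma F4_int (a : int) : a%:~R = (odd `|a|)%:R :> FF4.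
Proof.
have F4_nat n : n%:R = (odd n)%:R :> FF4.
  elim: n => // n IHn; rewrite -addn1 natrD IHn oddD addbT.
  case: (odd n); first exact: F4_addxx.
  exact: add0r.
case: a => n; first exact: F4_nat.
rewrite NegzE mulrNz -pmulrn abszN absz_nat.
by apply/esym/eqP; rewrite -addr_eq0 -!F4_nat; apply/eqP; exact: F4_addxx.
Qed.

Lemma mem_F4_enum x : x \in F4_enum.
Proof.
have [y <-] := red2_surj x; have [a [b ->]] := ZtauE y.
rewrite rmorphD rmorphM !rmorph_int !F4_int /F4_enum !inE.
have t : 1 + red2 tau = red2 tau + 1 by rewrite addrC.
by case: odd; case: odd; rewrite ?mul0r ?mul1r ?addr0 ?add0r ?t ?eqxx ?orbT.
Qed.

Definition F4_inv (x : FF4) : FF4 := x * x.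

Lemma F4_mulVf (x : FF4) : x != 0 -> F4_inv x * x = 1.
Proof.
have t2 := F4_tau_sqr; have tt := F4_addxx (red2 tau).
have h : (red2 tau + 1) * red2 tau = 1.
  by rewrite mulrDl t2 mul1r addrAC tt add0r.
have := mem_F4_enum x; rewrite !inE /F4_inv.
move=> /or4P[] /eqP-> => [|_|_|_]; rewrite ?eqxx ?mulr1 //.
  by rewrite t2.
have -> : (red2 tau + 1) * (red2 tau + 1) = red2 tau.
  rewrite mulrDr h mulr1 addrC -addrA F4_addxx addr0 //.
by rewrite mulrC.
Qed.

Lemma F4_inv0 : F4_inv 0 = 0.
Proof. exact: mul0r. Qed.

HB.instance Definition _ := GRing.ComNzRing_isField.Build FF4 F4_mulVf F4_inv0.

Lemma F4_enum_uniq : uniq F4_enum.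
Proof.
have t2 := F4_tau_sqr.
have t0 : red2 tau != 0.
  apply/eqP => t0; move/eqP: t2.
  by rewrite t0 mul0r add0r eq_sym oner_eq0.
have t1 : red2 tau != 1.
  apply/eqP => t1; move/eqP: t2.
  by rewrite t1 mul1r F4_addxx oner_eq0.
have t01 : red2 tau + 1 != 0.
  by apply: contra t1 => /eqP t01; rewrite -(addrK 1 (red2 tau)) t01 add0r
    -subr_eq0 -opprD F4_addxx oppr0.
have t11 : red2 tau + 1 != 1 by rewrite -subr_eq0 addrK.
have tt1 : red2 tau + 1 != red2 tau.
  by rewrite -subr_eq0 [_ + 1]addrC addrK oner_eq0.
by rewrite /= !inE !negb_or !(eq_sym 1) !(eq_sym 0) (eq_sym (red2 tau))
  oner_eq0 t0 t1 t01 t11 tt1.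
Qed.

Lemma F4_pickleK : pcancel (index^~ F4_enum) (onth F4_enum).
Proof. by move=> x; rewrite onthE (nth_map 0) ?index_mem ?nth_index ?mem_F4_enum. Qed.
HB.instance Definition _ := isCountable.Build FF4 F4_pickleK.

Lemma F4_enumP : Finite.axiom F4_enum.
Proof. by move=> x; rewrite count_uniq_mem ?F4_enum_uniq ?mem_F4_enum. Qed.
HB.instance Definition _ := isFinite.Build FF4 F4_enumP.

Lemma card_F4 : #|{: FF4}| = 4%N.
Proof. by rewrite cardT enumT unlock. Qed.

(* 0 is a junk value outside {3,4,5,6}. *)
Definition rho (k : nat) : Ztau :=
  match k with
  | 3 => 1 | 4 => 2 | 5 => tau ^+ 2 | 6 => 3
  | _ => 0
  end.

Definition mx4 (rows : seq (seq Ztau)) : 'M[Ztau]_4 :=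
  \matrix_(i, j) nth 0 (nth [::] rows i) j.

Definition r (k : nat) (i : 'I_4) : 'M[Ztau]_4 :=
  match val i with
  | 0 => mx4 [:: [:: -1; tau ^+ 2; 0; 0];
                 [:: 0; 1; 0; 0];
                 [:: 0; 0; 1; 0];
                 [:: 0; 0; 0; 1]]
  | 1 => mx4 [:: [:: 1; 0; 0; 0];
                 [:: 1; -1; 1; rho k];
                 [:: 0; 0; 1; 0];
                 [:: 0; 0; 0; 1]]
  | 2 => mx4 [:: [:: 1; 0; 0; 0];
                 [:: 0; 1; 0; 0];
                 [:: 0; 1; -1; 0];
                 [:: 0; 0; 0; 1]]
  | _ => mx4 [:: [:: 1; 0; 0; 0];
                 [:: 0; 1; 0; 0];
                 [:: 0; 0; 1; 0];
                 [:: 0; 1; 0; -1]]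
  end.

Lemma r_invol k i : r k i *m r k i = 1%:M.
Proof.
case: i => -[|[|[|[|//]]]] lti; apply/matrixP => a b;
  rewrite /r /= !mxE !big_ord_recl big_ord0 !mxE /=;
  case: a => -[|[|[|[|//]]]] lta; case: b => -[|[|[|[|//]]]] ltb;
  rewrite -!val_eqE /=; ring.
Qed.

Lemma red_r_unit k i : map_mx red2 (r k i) \in unitmx.
Proof.
by case: (@mulmx1_unit _ _ (map_mx red2 (r k i)) (map_mx red2 (r k i)));
   rewrite // -map_mxM r_invol map_mx1.
Qed.

Definition red_r (k : nat) (i : 'I_4) : {'GL_4[FF4]} :=
  FinRing.Unit (red_r_unit k i).

Lemma red_rE k i : GLval (red_r k i) = map_mx red2 (r k i).
Proof. by []. Qed.

Definition G2 (k : nat) : {group {'GL_4[FF4]}} :=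
  <<[set red_r k i | i : 'I_4]>>%G.

(* [injective s]: the generating set consists of n distinct involutions. *)
Definition Cgroup (gT : finGroupType) (n : nat) (G : {group gT})
    (s : 'I_n -> gT) : Prop :=
  [/\ G :=: <<[set s i | i : 'I_n]>>%g,
      injective s,
      forall i, #[s i]%g = 2%N
    & forall I J : {set 'I_n},
        (<<s @: I>> :&: <<s @: J>> = <<s @: (I :&: J)>>)%g].

(* Main.v *)
Require Import Defs.
From mathcomp Require Import all_boot all_order all_algebra all_fingroup.
From mathcomp Require Import all_solvable all_field.
From mathcomp Require Import ring.

(** Modulo 2 the signs disappear and every generator becomes a transvection
    [1 + e_i phi_i], where [e_i] is the i-th basis column and [phi_i] a row.
    The four rows [phi_i] span only a plane [U] with basis [phi_2], [phi_1], so
    every element of the group [G] moves each row vector by an element of [U].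
    On [U] the group acts through [SL_2(F_4)], which is isomorphic to [A_5].

    There is a column [f], with last entry 1, that is killed by all the [phi_i]
    and is therefore fixed by [G].  It gives rise to the elementary abelian group
    [K] of the sixteen matrices [1 + f y], [y] in [U], and conjugation by [g]
    carries [1 + f y] to [1 + f (y g)] ([translation_conj]).  So [G]
    normalises [K].  Let [H] be generated by [r_0, r_1, r_2].  These matrices fix
    the last basis row, while a nontrivial element of [K] moves it; hence [K]
    meets [H] trivially.  Moreover [h r_3 = 1 + f phi_2] for some [h] among [1],
    [r_2], [r_0], depending on the residue of [rho_k]
    ([icosahedral_mul_last]).  This puts [r_3] in [K H] and a nontrivial element
    of [K] in [G]; its conjugates generate [K], so [G] is the semidirect product
    of [K] by [H] ([G2_sdprod]).

    That [H] is [A_5], rather than an extension of [A_5] by part of the matrices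
    acting trivially on [U], is seen on the permutations that [r_0, r_1, r_2]
    induce on the five lines of [U]: the subgroup of [H x S_5] generated by the
    three pairs (matrix, permutation) has 60 elements and is the graph of an
    isomorphism ([icosahedral_isog_Alt]).

    For the intersection condition only the subgroups generated by proper subsets
    of the generators matter.  They have at most 160 elements, so they can be
    listed and their intersections compared directly.  Both finite verifications
    are run on matrices encoded as lists of bits, [a + b tau] being encoded as the
    pair [(a, b)]; [rho_k] only enters through its residue, which is 1, 0 or
    [tau ^ 2]. *)

Set Implicit Arguments.
Unset Strict Implicit.
Unset Printing Implicit Defensive.

(** * Semidirect products and graphs of isomorphisms *)

Section GroupIsomorphisms.

Import GroupScope.

(** The action is conjugation of [K] by [H], read through the two isomorphisms.
    An action has to be injective on the whole type, for every acting element, so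
    it is extended by the identity outside [R] and outside [D]. *)
Lemma sdprod_isog_sdprod_by (gT aT rT : finGroupType) (G K H : {group gT})
    (D : {group aT}) (R : {group rT}) :
  K ><| H = G -> R \isog K -> D \isog H ->
  exists act : groupAction D R, G \isog [set: sdprod_by act].
Proof.
case/sdprodP=> _ defG nKH tiKH /isogP[f injf imf] /isogP[h injh imh].
have hH a : a \in D -> h a \in H by move=> Da; rewrite -imh mem_morphim.
have fK x : x \in R -> f x \in K by move=> Rx; rewrite -imf mem_morphim.
have fKJ x a : x \in R -> a \in D -> f x ^ h a \in f @* R.
  by move=> Rx Da; rewrite imf memJ_norm ?fK // (subsetP nKH) ?hH.
pose to x a := if (a \in D) && (x \in R) then invm injf (f x ^ h a) else x.
have toR x a : x \in R -> a \in D -> to x a \in R.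
  move=> Rx Da; rewrite /to Da Rx /=.
  by have := mem_morphim (invm_morphism injf) (fKJ x a Rx Da) (fKJ x a Rx Da);
    rewrite /= im_invm.
have fto x a : x \in R -> a \in D -> f (to x a) = f x ^ h a.
  by move=> Rx Da; rewrite /to Da Rx /= invmK ?fKJ.
have to_action : is_action D to.
  split=> [a x y | x a b Da Db].
    have [Da | nDa] := boolP (a \in D); last by rewrite /to (negPf nDa).
    have [Rx | nRx] := boolP (x \in R); have [Ry | nRy] := boolP (y \in R).
    - move/(congr1 f); rewrite !fto // => /conjg_inj; exact: (injmP injf).
    - move=> e; have := toR _ _ Rx Da.
      by rewrite e /to (negPf nRy) andbF (negPf nRy).
    - move=> e; have := toR _ _ Ry Da.
      by rewrite -e /to (negPf nRx) andbF (negPf nRx).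
    - by rewrite /to (negPf nRx) (negPf nRy) !andbF.
  have [Rx | nRx] := boolP (x \in R); last first.
    by rewrite /to (negPf nRx) !andbF (negPf nRx) andbF.
  apply: (injmP injf); rewrite ?toR ?groupM //.
  by rewrite !fto ?toR ?groupM // morphM // conjgM.
pose toA := Action to_action.
have to_group : is_groupAction R toA.
  move=> a Da; rewrite inE; apply/andP; split.
    apply/subsetP=> x; rewrite inE actpermE /= /to Da /=.
    by case: ifP => //; rewrite eqxx.
  apply/morphicP=> x y Rx Ry; rewrite !actpermE /=.
  apply: (injmP injf); rewrite ?groupM ?toR ?groupM //.
  by rewrite fto ?groupM // morphM // morphM ?toR // !fto // conjMg.
pose act := GroupAction to_group.
have actf : {in R & D, morph_act act 'J f h} by move=> x a Rx Da; exact: fto.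
exists act; rewrite isog_sym; apply/isogP; exists (xsdprod_morphism actf).
  by rewrite injm_xsdprodm injf injh imf imh tiKH eqxx.
by rewrite /= im_xsdprodm imf imh.
Qed.

(** A subgroup of a product that meets both factors trivially is the graph of an
    isomorphism between its projections; here the projections are the two
    generated groups. *)
Lemma graph_isog (I : finType) (gT1 gT2 : finGroupType)
    (A : {set I}) (s1 : I -> gT1) (s2 : I -> gT2)
    (D := <<[set (s1 i, s2 i) | i in A]>>) :
  (forall x, (x, 1) \in D -> x = 1) -> (forall y, (1, y) \in D -> y = 1) ->
  <<s1 @: A>> \isog <<s2 @: A>>.
Proof.
move=> D1 D2.
have isog_proj (rT : finGroupType) (p : {morphism [set: gT1 * gT2] >-> rT}) :
    (forall z, z \in D -> p z = 1 -> z = 1) ->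
  D \isog <<[set p (s1 i, s2 i) | i in A]>>.
  move=> pK; apply/isogP; exists (restrm_morphism (subsetT D) p).
    apply/subsetP=> z; rewrite ker_restrm inE => /andP[Dz /mker pz].
    by apply/set1P; exact: pK.
  rewrite morphim_restrm setIid morphim_gen ?subsetT // morphimE setTI.
  by rewrite -imset_comp.
rewrite isog_sym.
apply: isog_trans (isog_proj _ (fst_morphism _ _) _); last first.
  by case=> x y /= Dxy x1; move: Dxy; rewrite x1 => /D2->.
rewrite isog_sym; apply: (isog_proj _ (snd_morphism _ _)).
by case=> x y /= Dxy y1; move: Dxy; rewrite y1 => /D1->.
Qed.

End GroupIsomorphisms.

(** * Listing a generated subgroup *)

Section Exploration.

Import GroupScope.

(** Group elements are represented by codes in [X], on which right
    multiplication by the i-th generator is a computable function [step i]. *)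
Variables (X : eqType) (step : nat -> X -> X).

(** Breadth-first search in the Cayley graph, at most [fuel] steps deep.  Too
    little fuel only makes the list incomplete, which [step_closed] detects. *)
Fixpoint explore (gens : seq nat) (fuel : nat) (seen frontier : seq X) :=
  if fuel is n.+1 then
    let fresh := undup [seq y <- [seq step i x | x <- frontier, i <- gens]
                          | y \notin seen] in
    if fresh is [::] then seen else explore gens n (fresh ++ seen) fresh
  else seen.

Definition step_closed (gens : seq nat) (L : seq X) :=
  all (fun x => all (fun i => step i x \in L) gens) L.

Variables (gT : finGroupType) (n : nat) (s : 'I_n -> gT) (code : gT -> X).
Variable x0 : X.
Hypothesis code1 : code 1 = x0.
Hypothesis code_step : forall g i, code (g * s i) = step i (code g).

Lemma mem_step_closed (I : {set 'I_n}) (gens : seq nat) (L : seq X) g :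
  {in I, forall i, val i \in gens} -> step_closed gens L -> x0 \in L ->
  g \in <<s @: I>> -> code g \in L.
Proof.
move=> sIgens clL L1 /gen_prodgP[m [c cI ->]].
elim: m c cI => [|m IHm] c cI; first by rewrite big_ord0 code1.
rewrite big_ord_recr /=; have /imsetP[i Ii ->] := cI ord_max.
rewrite code_step; apply: (allP (allP clL _ _)); last exact: sIgens.
by apply: IHm => j; exact: cI.
Qed.

Lemma mem_explore (I : {set 'I_n}) (gens : seq nat) fuel x :
  {in gens, forall i, exists2 i' : 'I_n, i' \in I & i = val i'} ->
  x \in explore gens fuel [:: x0] [:: x0] ->
  exists2 g, g \in <<s @: I>> & code g = x.
Proof.
move=> gensI; pose good y := exists2 g, g \in <<s @: I>> & code g = y.
have good1 : {in [:: x0], forall y, good y}.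
  by move=> y; rewrite inE => /eqP->; exists 1.
suff good_explore m seen fr : {in seen, forall y, good y} ->
    {in fr, forall y, good y} -> {in explore gens m seen fr, forall y, good y}.
  exact: good_explore.
elim: m seen fr => //= m IHm seen fr good_seen good_fr.
set fresh := undup _.
have good_fresh : {in fresh, forall y, good y}.
  move=> y; rewrite mem_undup mem_filter => /andP[_ /allpairsP[[z i] /=]].
  case=> /good_fr[g Gg <-] /gensI[j Ij ->] ->; exists (g * s j) => //.
  by rewrite groupM // mem_gen // imset_f.
case: fresh good_fresh => // a l good_fresh; apply: IHm => // y.
by rewrite mem_cat => /orP[/good_fresh | /good_seen].
Qed.

End Exploration.

(** * Arithmetic of the field with four elements on bits *)

Section Bits.

Import GRing.Theory.
Local Open Scope ring_scope.

Lemma oppr_F4 (x : FF4) : - x = x.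
Proof. by apply/eqP; rewrite eq_sym -addr_eq0 F4_addxx. Qed.

Definition bits := (bool * bool)%type.
Definition bits_val (p : bits) : FF4 := p.1%:R + p.2%:R * red2 tau.

Definition addb2 (p q : bits) : bits := (p.1 (+) q.1, p.2 (+) q.2).

(** Multiplication of [a + b tau] and [c + d tau], by [tau ^ 2 = tau + 1]. *)
Definition mulb2 (p q : bits) : bits :=
  let: (a, b) := p in let: (c, d) := q in
  ((a && c) (+) (b && d), (a && d) (+) (b && c) (+) (b && d)).

Definition bits_of (x : FF4) : bits :=
  nth (false, false)
    [:: (false, false); (true, false); (false, true); (true, true)]
    (index x F4_enum).

Lemma bits_ofK : cancel bits_of bits_val.
Proof.
move=> x; rewrite -{2}[x](nth_index 0 (mem_F4_enum x)) /bits_of /bits_val.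
have := mem_F4_enum x; rewrite -index_mem.
by case: (index _ _) => [|[|[|[|]]]] //= _;
  rewrite ?mul0r ?mul1r ?add0r ?addr0 // addrC.
Qed.

Lemma bits_valK : cancel bits_val bits_of.
Proof.
have inj : injective bits_of by exact: can_inj bits_ofK.
have [g gK Kg] : bijective bits_of.
  by apply: inj_card_bij inj _; rewrite card_prod !card_bool card_F4.
by move=> p; rewrite -[p]Kg bits_ofK.
Qed.

Lemma natF4D (a b : bool) : (a (+) b)%:R = a%:R + b%:R :> FF4.
Proof. by case: a b => [] []; rewrite ?addr0 ?add0r //= F4_addxx. Qed.

Lemma natF4M (a b : bool) : (a && b)%:R = a%:R * b%:R :> FF4.
Proof. by case: a b => [] []; rewrite ?mulr0 ?mulr1. Qed.

Lemma bits_ofD : {morph bits_of : x y / x + y >-> addb2 x y}.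
Proof.
suff valD p q : bits_val (addb2 p q) = bits_val p + bits_val q.
  by move=> x y; rewrite -{1}[x]bits_ofK -{1}[y]bits_ofK -valD bits_valK.
by rewrite /bits_val !natF4D mulrDl addrACA.
Qed.

Lemma bits_ofM : {morph bits_of : x y / x * y >-> mulb2 x y}.
Proof.
suff valM p q : bits_val (mulb2 p q) = bits_val p * bits_val q.
  by move=> x y; rewrite -{1}[x]bits_ofK -{1}[y]bits_ofK -valM bits_valK.
case: p q => [a b] [c d]; rewrite /bits_val /= !natF4D !natF4M.
by ring: F4_tau_sqr.
Qed.

End Bits.

(** * The reduced generators as transvections *)

Local Notation F0 := (false, false).
Local Notation F1 := (true, false).
Local Notation Ft2 := (true, true).

Section Transvections.

Import GroupScope GRing.Theory.
Local Open Scope ring_scope.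

Definition rho_bits (k : nat) : bits :=
  match k with 3 | 6 => F1 | 5 => Ft2 | _ => F0 end.

Lemma rho_bits_cases k : rho_bits k \in [:: F0; F1; Ft2].
Proof. by case: k => [|[|[|[|[|[|[|k]]]]]]]. Qed.

(** The rows [phi_i]; the argument [c] is the residue of [rho_k]. *)
Definition phi_bits (c : bits) (i : nat) : seq bits :=
  match i with
  | 0 => [:: F0; Ft2; F0; F0]
  | 1 => [:: F1; F0; F1; c]
  | _ => [:: F0; F1; F0; F0]
  end.

Definition phi (k : nat) (i : 'I_4) : 'rV[FF4]_4 :=
  \row_b bits_val (nth F0 (phi_bits (rho_bits k) i) b).

Lemma bits_val0 : bits_val F0 = 0.
Proof. by rewrite /bits_val mul0r addr0. Qed.

Lemma bits_val1 : bits_val F1 = 1.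
Proof. by rewrite /bits_val mul0r addr0. Qed.

Lemma bits_val_tau2 : bits_val Ft2 = red2 tau ^+ 2.
Proof. by rewrite /bits_val mul1r expr2 F4_tau_sqr addrC. Qed.

Lemma red2_rho k : red2 (rho k) = bits_val (rho_bits k).
Proof.
have two0 : 2 = 0 :> FF4 := red2_2.
case: k => [|[|[|[|[|[|[|k]]]]]]] /=;
  rewrite ?bits_val0 ?bits_val1 ?rmorph0 ?rmorph1 //.
- by rewrite rmorph_nat.
- by rewrite bits_val_tau2 rmorphXn.
- by rewrite rmorph_nat (natrD _ 2 1) two0 add0r.
Qed.

(** The i-th row is the only one in which the i-th generator differs from the
    identity. *)
Lemma red_r_transvection k i :
  GLval (red_r k i) = 1%:M + delta_mx i 0 *m phi k i.
Proof.
rewrite red_rE; apply/matrixP => a b.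
rewrite !mxE big_ord1 !mxE eqxx andbT.
case: i => -[|[|[|[|//]]]] lti; rewrite /r /= !mxE /=;
  case: a => -[|[|[|[|//]]]] lta; case: b => -[|[|[|[|//]]]] ltb;
  rewrite -!val_eqE /= ?bits_val0 ?bits_val1 ?bits_val_tau2 -?red2_rho;
  rewrite ?mul0r ?mul1r ?addr0 ?add0r;
  by rewrite ?rmorphN ?rmorphXn ?rmorph0 ?rmorph1 ?oppr_F4.
Qed.

Lemma mul_red_r k i m (A : 'M[FF4]_(m, 4)) :
  A *m GLval (red_r k i) = A + col i A *m phi k i.
Proof. by rewrite red_r_transvection mulmxDr mulmx1 mulmxA -colE. Qed.

Lemma red_r_sqr k i : (red_r k i ^+ 2 = 1)%g.
Proof.
apply: val_inj; have -> : (red_r k i ^+ 2 = red_r k i * red_r k i)%g by [].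
by rewrite [LHS]GL_MxE !red_rE -map_mxM r_invol map_mx1.
Qed.

End Transvections.

(** * Computable codes of matrices *)

Section MatrixCodes.

Import GroupScope GRing.Theory.
Local Open Scope ring_scope.

(** An explicit list, instead of [enum 'I_4], so that codes can be computed. *)
Definition ords4 : seq 'I_4 :=
  [:: Ordinal (isT : 0 < 4)%N; Ordinal (isT : 1 < 4)%N;
      Ordinal (isT : 2 < 4)%N; Ordinal (isT : 3 < 4)%N].

Lemma mem_ords4 i : i \in ords4.
Proof. by case: i => -[|[|[|[|//]]]] lti; rewrite !inE -!val_eqE. Qed.

Definition mx_code (g : {'GL_4[FF4]}) : seq (seq bits) :=
  [seq [seq bits_of (GLval g a b) | b <- ords4] | a <- ords4].

(** Right multiplication by [1 + e_i phi_i] adds to each row its i-th entry times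
    [phi_i]. *)
Definition mx_step (c : bits) (i : nat) (rows : seq (seq bits)) :=
  [seq [seq addb2 (nth F0 v b) (mulb2 (nth F0 v i) (nth F0 (phi_bits c i) b))
      | b <- iota 0 4] | v <- rows].

Lemma mx_code_inj : injective mx_code.
Proof.
move=> g h /eq_in_map e; apply: val_inj; apply/matrixP => a b.
have /eq_in_map ea := e a (mem_ords4 a).
exact: can_inj bits_ofK _ _ (ea b (mem_ords4 b)).
Qed.

Lemma mx_code_step k g i :
  mx_code (g * red_r k i)%g = mx_step (rho_bits k) i (mx_code g).
Proof.
have entry a b : GLval (g * red_r k i)%g a b
    = GLval g a b + GLval g a i * phi k i 0 b.
  by rewrite [GLval (g * red_r k i)%g]GL_MxE mul_red_r !mxE big_ord1 !mxE.
rewrite /mx_step /mx_code -[RHS]map_comp; apply: eq_map => a /=.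
rewrite !entry !bits_ofD !bits_ofM !mxE !bits_valK {entry}.
by case: i => -[|[|[|[|//]]]] lti /=;
   rewrite (bool_irrelevance lti isT).
Qed.

Definition mx_code1 : seq (seq bits) :=
  [:: [:: F1; F0; F0; F0]; [:: F0; F1; F0; F0];
      [:: F0; F0; F1; F0]; [:: F0; F0; F0; F1]].

Lemma mx_codeE1 : mx_code 1%g = mx_code1.
Proof.
have bits0 : bits_of 0 = F0 by rewrite -bits_val0 bits_valK.
have bits1 : bits_of 1 = F1 by rewrite -bits_val1 bits_valK.
by rewrite /mx_code /= !mxE -!val_eqE /= bits0 bits1.
Qed.

Lemma mx_code_red_r k i : mx_code (red_r k i) = mx_step (rho_bits k) i mx_code1.
Proof. by rewrite -[red_r k i]mul1g mx_code_step mx_codeE1. Qed.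

End MatrixCodes.

(** * The intersection condition *)

Section Intersections.

Import GroupScope GRing.Theory.
Local Open Scope ring_scope.

Definition parabolic (fuel : nat) (c : bits) (m : bitseq) :=
  explore (mx_step c) (mask m (iota 0 4)) fuel [:: mx_code1] [:: mx_code1].

(** The full set is left out: intersecting with the whole group is trivial, and
    its 960 elements need not be listed. *)
Definition proper_masks : seq bitseq :=
  let extend ms := [seq b :: m | b <- [:: false; true], m <- ms] in
  [seq m <- iter 4 extend [:: [::]] | ~~ all id m].

Definition meet_mask (m1 m2 : bitseq) := [seq p.1 && p.2 | p <- zip m1 m2].

(** Closed lists contain the codes of the whole subgroups.  Of the intersection
    condition only one inclusion is tested, the other one being valid in every
    group. *)
Definition parabolics_ok
    (tbl : seq (bitseq * seq (seq (seq bits)))) (c : bits) :=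
  all (fun p => (mx_code1 \in p.2) &&
         step_closed (mx_step c) (mask p.1 (iota 0 4)) p.2) tbl
  && all (fun p => all (fun q => all (fun x => (x \in q.2) ==>
       has (fun r => (r.1 == meet_mask p.1 q.1) && (x \in r.2)) tbl)
       p.2) tbl) tbl.

Definition parabolic_table fuel c :=
  [seq (m, parabolic fuel c m) | m <- proper_masks].

Definition mask_of (I : {set 'I_4}) : bitseq := [seq i \in I | i <- ords4].

Lemma mask_ofE I :
  mask (mask_of I) (iota 0 4) = [seq val i | i <- ords4 & i \in I].
Proof. by rewrite filter_mask map_mask. Qed.

Lemma mask_of_proper I : I != setT -> mask_of I \in proper_masks.
Proof.
move=> nIT; have: ~~ all id (mask_of I).
  apply: contra nIT; rewrite all_map => /allP IT.
  by apply/eqP/setP=> i; rewrite inE; apply: IT; exact: mem_ords4.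
rewrite /mask_of /=; by do 4!case: (_ \in I).
Qed.

Lemma meet_mask_of I J : meet_mask (mask_of I) (mask_of J) = mask_of (I :&: J).
Proof. by rewrite /meet_mask /mask_of /= !inE. Qed.

Section ProperParabolics.

Variables k fuel : nat.
Hypothesis tbl_ok :
  parabolics_ok (parabolic_table fuel (rho_bits k)) (rho_bits k).

Lemma code_parabolic (I : {set 'I_4}) x :
  x \in parabolic fuel (rho_bits k) (mask_of I) ->
  exists2 g, g \in <<red_r k @: I>>%g & mx_code g = x.
Proof.
rewrite /parabolic mask_ofE.
have gensI : {in [seq val i | i <- ords4 & i \in I],
    forall j, exists2 i, i \in I & j = val i}.
  by move=> _ /mapP[i /[!mem_filter] /andP[Ii _] ->]; exists i.
exact: (mem_explore mx_codeE1 (@mx_code_step k) gensI).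
Qed.

Lemma parabolic_code (I : {set 'I_4}) g :
  I != setT -> g \in <<red_r k @: I>>%g ->
  mx_code g \in parabolic fuel (rho_bits k) (mask_of I).
Proof.
move=> nIT gI; have /andP[/allP tbl_cl _] := tbl_ok.
have /andP[L1 clL] := tbl_cl _ (map_f _ (mask_of_proper nIT)).
have gensI : {in I, forall i, val i \in mask (mask_of I) (iota 0 4)}.
  move=> i Ii; rewrite mask_ofE; apply: map_f.
  by rewrite mem_filter Ii; exact: mem_ords4.
exact: (mem_step_closed mx_codeE1 (@mx_code_step k) gensI clL L1 gI).
Qed.

(** Codes of elements of a parabolic subgroup lie in its list since the list is
    closed; conversely a code in the list for the intersection of the masks comes
    from an element of the corresponding subgroup, which is the given one because
    codes are injective. *)
Lemma parabolic_meet (I J : {set 'I_4}) :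
  (<<red_r k @: I>> :&: <<red_r k @: J>> = <<red_r k @: (I :&: J)>>)%g.
Proof.
apply/eqP; rewrite eqEsubset; apply/andP; split; last first.
  by rewrite subsetI !genS ?imsetS ?subsetIl ?subsetIr.
have [-> | nIT] := eqVneq I setT; first by rewrite setTI subsetIr.
have [-> | nJT] := eqVneq J setT; first by rewrite setIT subsetIl.
apply/subsetP=> g /setIP[/(parabolic_code nIT) gI /(parabolic_code nJT) gJ].
have /andP[_ /allP meet_ok] := tbl_ok.
pose entry m := (m, parabolic fuel (rho_bits k) m).
have tblI := map_f entry (mask_of_proper nIT).
have tblJ := map_f entry (mask_of_proper nJT).
have /implyP/(_ gJ)/hasP[_ /mapP[m _ ->]] :=
  allP (allP (meet_ok _ tblI) _ tblJ) _ gI.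
rewrite meet_mask_of => /andP[/eqP /= -> /code_parabolic[h Hh /mx_code_inj <-]].
exact: Hh.
Qed.

End ProperParabolics.

(** The depth 40 exceeds the diameters of the Cayley graphs involved; residue 1
    serves both k = 3 and k = 6. *)
Lemma parabolic_tables_ok :
  all (fun c => parabolics_ok (parabolic_table 40 c) c) [:: F0; F1; Ft2].
Proof. by lazy. Qed.

Lemma Cgroup_G2 k : Cgroup (G2 k) (red_r k).
Proof.
have code_c := rho_bits_cases k.
split=> //.
- move=> i j /(congr1 mx_code); rewrite !mx_code_red_r => e.
  apply/eqP; move: e; move: code_c; rewrite !inE => /or3P[] /eqP->;
  by case: i => -[|[|[|[|//]]]] lti; case: j => -[|[|[|[|//]]]] ltj.
- move=> i; apply: nt_prime_order => //.
    exact: red_r_sqr.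
  apply/eqP=> /(congr1 mx_code); rewrite mx_code_red_r mx_codeE1.
  move: code_c; rewrite !inE => /or3P[] /eqP->;
  by case: i => -[|[|[|[|//]]]] lti.
- apply: (@parabolic_meet _ 40); exact: (allP parabolic_tables_ok).
Qed.

End Intersections.

(** * The complement: the alternating group on five lines *)

Section Icosahedral.

Import GroupScope GRing.Theory.
Local Open Scope ring_scope.

(** A quotient of the Coxeter group of the icosahedron. *)
Definition icosahedral k : {group {'GL_4[FF4]}} :=
  <<[set red_r k i | i in [set~ ord_max]]>>%G.

Definition ords5 : seq 'I_5 :=
  [:: Ordinal (isT : 0 < 5)%N; Ordinal (isT : 1 < 5)%N; Ordinal (isT : 2 < 5)%N;
      Ordinal (isT : 3 < 5)%N; Ordinal (isT : 4 < 5)%N].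

Lemma mem_ords5 i : i \in ords5.
Proof. by case: i => -[|[|[|[|[|//]]]]] lti; rewrite !inE -!val_eqE. Qed.

(** The permutations induced on the five lines of the plane spanned by [phi_1]
    and [phi_2].  The lines spanned by [phi_2], [phi_1], [phi_1 + phi_2],
    [phi_1 + tau phi_2] and [phi_1 + tau ^ 2 phi_2] are numbered from 0 to 4; on
    the coordinate [z] of the line of [phi_1 + z phi_2] the generators 0, 1, 2
    act as [z + tau ^ 2], [z / (z + 1)] and [z + 1]. *)
Definition line_image (i : nat) : seq nat :=
  match i with
  | 0 => [:: 0; 4; 3; 2; 1]
  | 1 => [:: 2; 1; 0; 4; 3]
  | _ => [:: 0; 2; 1; 4; 3]
  end.

(** The products of transpositions make it plain that these permutations are
    even. *)
Definition line_perm (i : 'I_4) : 'S_5 :=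
  let swap a b := tperm (nth ord0 ords5 a) (nth ord0 ords5 b) in
  match val i with
  | 0 => (swap 1%N 4%N * swap 2%N 3%N)%g
  | 1 => (swap 0%N 2%N * swap 3%N 4%N)%g
  | _ => (swap 1%N 2%N * swap 3%N 4%N)%g
  end.

Lemma line_permE i j : val (line_perm i j) = nth 0 (line_image i) j.
Proof.
case: i j => -[|[|[|[|//]]]] lti [[|[|[|[|[|//]]]]] ltj];
  by rewrite /line_perm /= permM !permE /= ?permE.
Qed.

Lemma line_perm_Alt i : line_perm i \in 'Alt_('I_5).
Proof.
by rewrite Alt_even; case: i => -[|[|[|[|//]]]] lti;
  rewrite /line_perm /= odd_permM !odd_tperm -!val_eqE.
Qed.

Definition perm_code (p : 'S_5) : seq nat := [seq val (p j) | j <- ords5].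

Lemma perm_code_inj : injective perm_code.
Proof.
move=> p q /eq_in_map e; apply/permP=> j; apply: val_inj.
exact: e (mem_ords5 j).
Qed.

Lemma perm_codeE1 : perm_code 1%g = iota 0 5.
Proof. by rewrite /perm_code /= !perm1. Qed.

Definition graph_code (z : {'GL_4[FF4]} * 'S_5) :=
  (mx_code z.1, perm_code z.2).

Definition graph_step (c : bits) (i : nat) (x : seq (seq bits) * seq nat) :=
  (mx_step c i x.1, [seq nth 0 (line_image i) j | j <- x.2]).

Definition graph_gen k (i : 'I_4) := (red_r k i, line_perm i).

Lemma graph_code_step k z i :
  graph_code (z * graph_gen k i)%g = graph_step (rho_bits k) i (graph_code z).
Proof.
case: z => g p; congr (_, _); first exact: mx_code_step.
by rewrite /graph_code /perm_code /= !permM !line_permE.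
Qed.

Definition graph_code1 := (mx_code1, iota 0 5).

Lemma graph_codeE1 : graph_code 1%g = graph_code1.
Proof. by congr (_, _); [exact: mx_codeE1 | exact: perm_codeE1]. Qed.

Definition graph_elements fuel c :=
  explore (graph_step c) (iota 0 3) fuel [:: graph_code1] [:: graph_code1].

(** The third condition says that the pairs form the graph of a bijection. *)
Definition graph_ok fuel c :=
  let L := graph_elements fuel c in
  [&& graph_code1 \in L, step_closed (graph_step c) (iota 0 3) L,
      all (fun x => (x.1 == mx_code1) == (x.2 == iota 0 5)) L,
      uniq [seq x.1 | x <- L] & size L == 60].

Lemma graph_okP : all (graph_ok 40) [:: F0; F1; Ft2].
Proof. by lazy. Qed.

(** The line permutations are even, so they generate a subgroup of [A_5]; it is
    everything because the list exhibits 60 matrices. *)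
Lemma icosahedral_isog_Alt k fuel : graph_ok fuel (rho_bits k) ->
  'Alt_('I_5) \isog icosahedral k.
Proof.
case/and5P=> L1 clL /allP fixL uniqL /eqP szL.
rewrite /icosahedral /=; set A := [set~ ord_max].
have AE (i : 'I_4) : (i \in A) = (val i \in iota 0 3).
  by rewrite !inE -val_eqE; case: i => -[|[|[|[|//]]]].
have DL z : z \in <<[set graph_gen k i | i in A]>>%g ->
    graph_code z \in graph_elements fuel (rho_bits k).
  apply: (mem_step_closed graph_codeE1 (@graph_code_step k)) clL _ => // i.
  by rewrite AE.
have LD x : x \in graph_elements fuel (rho_bits k) ->
    exists2 z, z \in <<[set graph_gen k i | i in A]>>%g & graph_code z = x.
  have gensA : {in iota 0 3, forall j, exists2 i, i \in A & j = val i}.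
    move=> j j3; have ltj : (j < 4)%N by move: j3; rewrite mem_iota => /ltnW.
    by exists (Ordinal ltj); rewrite ?AE.
  exact: (mem_explore graph_codeE1 (@graph_code_step k) gensA).
have isoHs : <<red_r k @: A>> \isog <<line_perm @: A>>.
  have fixD g p : (g, p) \in <<[set graph_gen k i | i in A]>>%g ->
      (mx_code g == mx_code1) = (perm_code p == iota 0 5).
    by move/DL/fixL/eqP.
  apply: graph_isog => [g /fixD | p /fixD].
    by rewrite perm_codeE1 eqxx -mx_codeE1 => /eqP/mx_code_inj.
  by rewrite mx_codeE1 eqxx -perm_codeE1 => /esym/eqP/perm_code_inj.
suff <- : <<line_perm @: A>>%g = 'Alt_('I_5) by rewrite isog_sym.
apply/eqP; rewrite eqEcard gen_subG; apply/andP; split.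
  by apply/subsetP=> _ /imsetP[i _ ->]; exact: line_perm_Alt.
have -> : #|'Alt_('I_5)| = 60.
  by apply/eqP; rewrite -(eqn_pmul2l (isT : 0 < 2)%N) card_Alt card_ord.
rewrite -(card_isog isoHs) -szL -(size_map fst).
have memL : {subset [seq x.1 | x <- graph_elements fuel (rho_bits k)]
                <= [seq mx_code g | g in <<red_r k @: A>>%g]}.
  move=> _ /mapP[x /LD[[g p] Dgp <-] ->] /=; apply: map_f; rewrite mem_enum.
  have: g \in fst_morphism _ _ @* <<[set graph_gen k i | i in A]>>.
    by apply/morphimP; exists (g, p).
  by rewrite morphim_gen ?subsetT // morphimE setTI -imset_comp.
by rewrite (leq_trans (uniq_leq_size uniqL memL)) // size_map -cardE.
Qed.

End Icosahedral.

(** * The normal subgroup of translations *)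

Section Translations.

Import GroupScope GRing.Theory.
Local Open Scope ring_scope.

(** Row 0 is [phi_2] and row 1 is [phi_1]. *)
Definition plane_basis (k : nat) : 'M[FF4]_(2, 4) :=
  \matrix_(a, b) phi k (nth ord0 ords4 (2 - a)) 0 b.

Definition phi_coord (i : 'I_4) : 'rV[FF4]_2 :=
  \row_a bits_val (nth F0
    match val i with
    | 0 => [:: Ft2; F0] | 1 => [:: F0; F1] | _ => [:: F1; F0]
    end a).

Lemma phi_plane k i : phi k i = phi_coord i *m plane_basis k.
Proof.
apply/rowP => b; rewrite !mxE !big_ord_recl big_ord0 !mxE /=.
case: i => -[|[|[|[|//]]]] lti; case: b => -[|[|[|[|//]]]] ltb;
 rewrite /= ?bits_val0 ?bits_val1 ?mul0r ?mulr0 ?mul1r ?mulr1;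
 by rewrite ?addr0 ?add0r.
Qed.

(** The entries solve [phi_i f = 0] for all i and [f_3 = 1].  Among the solutions,
    this one makes [translation k (phi_coord ord_max)] a product of [r_3] and an
    element fixing the last basis row. *)
Definition fixed_col (k : nat) : 'cV[FF4]_4 :=
  \col_a bits_val (nth F0
    (if rho_bits k == F1 then [:: F0; F0; F1; F1]
     else [:: rho_bits k; F0; F0; F1]) a).

Lemma phi_fixed_col k i : phi k i *m fixed_col k = 0.
Proof.
apply/rowP => b; rewrite !mxE !big_ord_recl big_ord0 !mxE {b} /=.
case: eqP => [->|_]; case: i => -[|[|[|[|//]]]] lti;
 rewrite /= ?bits_val0 ?bits_val1 ?mul0r ?mulr0 ?mul1r ?mulr1;
 by rewrite ?addr0 ?add0r ?F4_addxx.
Qed.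

Lemma plane_fixed_col k : plane_basis k *m fixed_col k = 0.
Proof.
apply/matrixP=> a j.
have /matrixP/(_ 0 j) e := phi_fixed_col k (nth ord0 ords4 (2 - a)).
by rewrite !mxE in e *; rewrite -[RHS]e; apply: eq_bigr => b _; rewrite !mxE.
Qed.

Definition translation_mx k (w : 'rV[FF4]_2) : 'M[FF4]_4 :=
  1%:M + fixed_col k *m (w *m plane_basis k).

(** The cross term [f y f z] vanishes because [f] is killed by the plane. *)
Lemma translation_mxD k w1 w2 :
  translation_mx k w1 *m translation_mx k w2 = translation_mx k (w1 + w2).
Proof.
rewrite /translation_mx mulmxDr mulmx1 mulmxDl mul1mx.
rewrite -[_ *m _ *m (_ *m _)]mulmxA (mulmxA (w1 *m _)) -(mulmxA w1).
by rewrite plane_fixed_col mulmx0 mul0mx mulmx0 addr0 mulmxDl mulmxDr addrA.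
Qed.

Lemma translation_mx_unit k w : translation_mx k w \in unitmx.
Proof.
have ww : w + w = 0 by apply/rowP=> j; rewrite !mxE F4_addxx.
have [] := @mulmx1_unit _ _ (translation_mx k w) (translation_mx k w) => //.
by rewrite translation_mxD ww /translation_mx mul0mx mulmx0 addr0.
Qed.

(** These matrices fix [U] pointwise and move the last basis row by the vectors
    of [U]. *)
Definition translation k (w : 'rV[FF4]_2) : {'GL_4[FF4]} :=
  FinRing.Unit (translation_mx_unit k w).

Lemma translationM k : {in setT &, {morph translation k : w1 w2 / (w1 * w2)%g}}.
Proof.
move=> w1 w2 _ _; apply: val_inj; rewrite [RHS]GL_MxE.
exact/esym/translation_mxD.
Qed.

Canonical translation_morphism k := Morphism (@translationM k).

Definition translations k : {group {'GL_4[FF4]}} := (translation k @* setT)%G.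

Lemma plane_basis_inj k (w : 'rV_2) : w *m plane_basis k = 0 -> w = 0.
Proof.
(* Entry 1 of [w B] is [w_0] and entry 0 is [w_1]. *)
move/rowP=> wB0.
have w0 := wB0 (nth ord0 ords4 1); have w1 := wB0 (nth ord0 ords4 0).
move: w0 w1; rewrite !mxE !big_ord_recl !big_ord0 !mxE /= ?bits_val0 ?bits_val1.
rewrite !mulr0 !mulr1 !addr0 add0r => w0 w1.
apply/rowP=> -[[|[|//]] ltj]; rewrite mxE.
  by rewrite -[RHS]w0; congr (w _ _); exact: val_inj.
by rewrite -[RHS]w1; congr (w _ _); exact: val_inj.
Qed.

Lemma last_row_translation k w :
  delta_mx 0 ord_max *m GLval (translation k w)
    = delta_mx 0 ord_max + w *m plane_basis k.
Proof.
rewrite /= mulmxDr mulmx1 (mulmxA _ (fixed_col k)) -rowE; congr (_ + _).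
have -> : row ord_max (fixed_col k) = 1%:M.
  apply/rowP=> j; rewrite !mxE ord1 eqxx; case: ifP => _; exact: bits_val1.
by rewrite mul1mx.
Qed.

Lemma injm_translation k : 'injm (translation k).
Proof.
apply/subsetP=> w /morphpreP[_ /set1P tw1]; apply/set1P.
apply: (@plane_basis_inj k); apply: (addrI (delta_mx 0 ord_max)).
by rewrite -last_row_translation tw1 addr0 /= mulmx1.
Qed.

Lemma translations_isog k : [set: 'rV['Z_2]_4] \isog translations k.
Proof.
have abelem2 (V : finZmodType) :
  (forall x : V, x + x = 0) -> 2.-abelem [set: V].
  move=> xx; apply/abelemP=> //.
  split=> [|x _]; first exact: FinRing.zmod_abelian.
  by rewrite FinRing.zmodXgE mulr2n xx.
rewrite (@isog_abelem_card _ _ 2).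
  have -> : 2.-abelem (translations k).
    apply: morphim_abelem; apply: abelem2 => w.
    by apply/rowP=> j; rewrite !mxE F4_addxx.
  rewrite card_injm ?injm_translation // !cardsT.
  by rewrite !card_mx card_F4 card_ord.
apply: abelem2 => x; apply/rowP=> j; rewrite !mxE.
by case: (x 0 j) => -[|[|//]] lti; exact: val_inj.
Qed.

(** The matrix, on coordinates in [plane_basis], of the action of the i-th
    generator on the plane. *)
Definition plane_action k (i : 'I_4) : 'M[FF4]_2 :=
  1%:M + col i (plane_basis k) *m phi_coord i.

(** Since the generator fixes [f], it carries [1 + f y] to [1 + f (y r_i)]. *)
Lemma translation_conj k i w :
  (translation k w ^ red_r k i = translation k (w *m plane_action k i))%g.
Proof.
apply: (mulgI (red_r k i)); rewrite -conjgC; apply: val_inj.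
rewrite [LHS]GL_MxE [RHS]GL_MxE mul_red_r /=.
rewrite /translation_mx mulmxDr mulmx1.
have -> : map_mx red2 (r k i)
    *m (fixed_col k *m (w *m plane_action k i *m plane_basis k))
  = fixed_col k *m (w *m plane_action k i *m plane_basis k).
  rewrite mulmxA; congr (_ *m _).
  rewrite -red_rE red_r_transvection mulmxDl mul1mx -mulmxA.
  by rewrite phi_fixed_col mulmx0 addr0.
rewrite -red_rE red_r_transvection.
rewrite linearD /= !colE mul1mx mulmxDl.
rewrite /plane_action mulmxDr mulmx1 mulmxDl -!mulmxA -phi_plane mulmxDr.
by rewrite colE -!mulmxA addrACA addrA.
Qed.

Lemma red_r_G2 k i : red_r k i \in G2 k.
Proof. by rewrite mem_gen ?imset_f. Qed.

Lemma G2_norm_translations k : G2 k \subset 'N(translations k).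
Proof.
rewrite gen_subG; apply/subsetP=> _ /imsetP[i _ ->]; rewrite inE.
apply/subsetP=> _ /imsetP[_ /morphimP[w _ _ ->] ->].
by rewrite translation_conj mem_morphim ?inE.
Qed.

End Translations.

(** * The semidirect decomposition *)

Section Decomposition.

Import GroupScope GRing.Theory.
Local Open Scope ring_scope.

Lemma red_r_icosahedral k i : i != ord_max -> red_r k i \in icosahedral k.
Proof. by move=> ni; rewrite mem_gen // imset_f // !inE. Qed.

Lemma icosahedral_sub_G2 k : icosahedral k \subset G2 k.
Proof.
by rewrite genS //; apply/subsetP=> _ /imsetP[i _ ->]; rewrite imset_f.
Qed.

Lemma red_r_mul_last k i : phi k i 0 ord_max = 0 ->
  GLval (red_r k i * red_r k ord_max)%g
    = 1%:M + (delta_mx i 0 *m phi k i + delta_mx ord_max 0 *m phi k ord_max).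
Proof.
move=> phi0; rewrite GL_MxE mul_red_r red_r_transvection linearD /= !colE.
rewrite mul1mx -mulmxA.
have -> : phi k i *m delta_mx ord_max 0 = 0 :> 'M_1.
  by apply/rowP=> j; rewrite -colE mxE phi0 mxE.
by rewrite mulmx0 addr0 addrA.
Qed.

(** When [rho_k] has residue 0 the generator [r_3] is itself a translation; when
    it is 1, respectively [tau ^ 2], then [r_3] acts on the plane like [r_2],
    respectively [r_0]. *)
Lemma icosahedral_mul_last k : exists2 h, h \in icosahedral k &
  (h * red_r k ord_max = translation k (phi_coord ord_max))%g.
Proof.
pose o := nth ord0 ords4; pose t := translation k (phi_coord ord_max).
have valt e : fixed_col k = e -> GLval t = 1%:M + e *m phi k ord_max.
  by move=> <-; rewrite phi_plane.
have := rho_bits_cases k; rewrite !inE => /or3P[] /eqP rhok.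
- exists 1%g; first exact: group1.
  apply: val_inj; rewrite mul1g [LHS]red_r_transvection.
  rewrite [RHS](@valt (delta_mx ord_max 0)) //.
  by apply/colP=> -[[|[|[|[|//]]]] ltj];
    rewrite !mxE rhok /= ?bits_val0 ?bits_val1.
- exists (red_r k (o 2%N)); first by rewrite red_r_icosahedral.
  have phi2 : phi k (o 2%N) = phi k ord_max by apply/rowP=> b; rewrite !mxE.
  apply: val_inj; rewrite [LHS]red_r_mul_last; last by rewrite mxE bits_val0.
  rewrite phi2 -mulmxDl; apply/esym/valt.
  by apply/colP=> -[[|[|[|[|//]]]] ltj];
    rewrite !mxE rhok /= ?bits_val0 ?bits_val1 ?addr0 ?add0r.
- exists (red_r k (o 0%N)); first by rewrite red_r_icosahedral.
  have phi0 : phi k (o 0%N) = bits_val Ft2 *: phi k ord_max.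
    by apply/rowP=> -[[|[|[|[|//]]]] ltb];
      rewrite !mxE /= ?bits_val0 ?bits_val1 ?mulr0 ?mulr1.
  apply: val_inj; rewrite [LHS]red_r_mul_last; last by rewrite mxE bits_val0.
  rewrite phi0 -scalemxAr scalemxAl -mulmxDl; apply/esym/valt.
  apply/colP=> -[[|[|[|[|//]]]] ltj];
   by rewrite !mxE rhok /= ?bits_val0 ?bits_val1 ?mulr0 ?mulr1 ?addr0 ?add0r.
Qed.

(** Among the generators only [r_3] moves the last basis row. *)
Lemma last_row_icosahedral k h : h \in icosahedral k ->
  delta_mx 0 ord_max *m GLval h = delta_mx 0 ord_max :> 'rV_4.
Proof.
pose S := [set h : {'GL_4[FF4]} |
  delta_mx 0 ord_max *m GLval h == delta_mx 0 ord_max :> 'rV_4].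
have gS : group_set S.
  apply/group_setP; split=> [|x y]; first by rewrite inE /= mulmx1.
  rewrite !inE GL_MxE => /eqP xf /eqP yf.
  by rewrite mulmxA xf yf.
have: icosahedral k \subset Group gS.
  rewrite gen_subG; apply/subsetP=> _ /imsetP[i ni ->]; rewrite inE mul_red_r.
  rewrite -[X in _ == X]addr0; apply/eqP; congr (_ + _).
  apply/rowP=> j; rewrite !mxE big_ord1 !mxE.
  by move: ni; rewrite !inE => /negPf->; rewrite andbF mul0r.
by move/subsetP=> sub /sub; rewrite inE => /eqP.
Qed.

Lemma translations_TI_icosahedral k : translations k :&: icosahedral k = 1%g.
Proof.
apply/trivgP; apply/subsetP=> _ /setIP[/morphimP[w _ _ ->]].
move/last_row_icosahedral.
rewrite last_row_translation -[RHS]addr0 => /addrI/plane_basis_inj->.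
by rewrite -FinRing.zmod1gE morph1 set11.
Qed.

Lemma plane_actionE k i w :
  w *m plane_action k i = w + (w *m plane_basis k) 0 i *: phi_coord i.
Proof.
rewrite mulmxDr mulmx1 mulmxA; congr (_ + _).
rewrite [_ *m col _ _]mx11_scalar mul_scalar_mx; congr (_ *: _).
by rewrite !mxE; apply: eq_bigr => a _; rewrite !mxE.
Qed.

(** The coordinates of the translations in [G] form an additive subgroup stable
    under the action of the generators.  As each generator moves [w] by a multiple
    of one vector, stability produces new vectors: [phi_2] gives [phi_1] through
    [r_1], this gives [tau ^ 2 phi_2] through [r_0], and this gives
    [tau ^ 2 phi_1] through [r_1].  Those four span the plane over [F_2]. *)
Lemma translations_sub_G2 k : translations k \subset G2 k.
Proof.
pose A := (translation k @*^-1 (G2 k))%G; pose o := nth ord0 ords4.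
have actA i w : w \in A -> w *m plane_action k i \in A.
  move=> /morphpreP[_ Gw]; apply/morphpreP; split; first exact: in_setT.
  by have := groupJ Gw (red_r_G2 k i); rewrite translation_conj.
have addA w1 w2 : w1 \in A -> w2 \in A -> w1 + w2 \in A by exact: groupM.
have jumpA i w : w \in A -> (w *m plane_basis k) 0 i *: phi_coord i \in A.
  move=> Aw; rewrite -[_ *: _](addKr w) -plane_actionE addA ?actA //.
  by rewrite -[- w]/(w^-1)%g groupV.
have A2 : phi_coord (o 2%N) \in A.
  apply/morphpreP; split; first exact: in_setT.
  have [h Hh defh] := icosahedral_mul_last k.
  have -> : phi_coord (o 2%N) = phi_coord ord_max.
    by apply/rowP=> a; rewrite !mxE.
  by rewrite /= -defh groupM ?red_r_G2 // (subsetP (icosahedral_sub_G2 k)).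
have spanA v x : v \in A -> red2 tau ^+ 2 *: v \in A -> x *: v \in A.
  move=> Av At2v.
  have t2 : red2 tau ^+ 2 = red2 tau + 1 by rewrite expr2 F4_tau_sqr.
  have := mem_F4_enum x; rewrite !in_cons in_nil orbF => /or4P[] /eqP->.
  - rewrite scale0r -FinRing.zmod1gE; exact: group1.
  - by rewrite scale1r.
  - by rewrite -[red2 tau](addrK 1) -t2 oppr_F4 scalerDl scale1r; exact: addA.
  - by rewrite -t2.
have stepA i j : phi_coord j \in A -> phi k j 0 i *: phi_coord i \in A.
  by rewrite phi_plane; exact: jumpA.
have A1 : phi_coord (o 1%N) \in A.
  by have := stepA (o 1%N) _ A2; rewrite mxE bits_val1 scale1r.
have A0 : red2 tau ^+ 2 *: phi_coord (o 2%N) \in A.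
  have <- : phi_coord (o 0%N) = red2 tau ^+ 2 *: phi_coord (o 2%N).
    apply/rowP=> -[[|[|//]] lta];
    by rewrite !mxE /= ?bits_val0 ?bits_val1 ?bits_val_tau2 ?mulr0 ?mulr1.
  by have := stepA (o 0%N) _ A1; rewrite mxE bits_val1 scale1r.
have A01 : red2 tau ^+ 2 *: phi_coord (o 1%N) \in A.
  have := jumpA (o 1%N) _ A0; rewrite -scalemxAl -phi_plane !mxE.
  by rewrite bits_val1 mulr1.
apply/subsetP=> _ /morphimP[w _ _ ->]; suff: w \in A by case/morphpreP.
have -> : w = w 0 ord0 *: phi_coord (o 2%N) + w 0 ord_max *: phi_coord (o 1%N).
  apply/rowP=> -[[|[|//]] lta]; rewrite !mxE /= ?bits_val0 ?bits_val1.
    by rewrite mulr0 mulr1 addr0; congr (w _ _); exact: val_inj.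
  by rewrite mulr0 mulr1 add0r; congr (w _ _); exact: val_inj.
exact: addA (spanA _ _ A2 A0) (spanA _ _ A1 A01).
Qed.

Lemma G2_sdprod k : translations k ><| icosahedral k = G2 k.
Proof.
have nKH : icosahedral k \subset 'N(translations k).
  exact: subset_trans (icosahedral_sub_G2 k) (G2_norm_translations k).
rewrite sdprodE // ?translations_TI_icosahedral // -norm_joinEr //.
apply/eqP; rewrite eqEsubset join_subG.
rewrite translations_sub_G2 // icosahedral_sub_G2 /=.
rewrite gen_subG; apply/subsetP=> _ /imsetP[i _ ->].
have [-> | ni] := eqVneq i ord_max; last first.
  by rewrite mem_gen // inE red_r_icosahedral ?orbT.
have [h Hh defh] := icosahedral_mul_last k.
rewrite -[red_r k _](mulKg h) defh.
rewrite groupM ?groupV // mem_gen // inE ?Hh ?orbT //.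
by rewrite mem_morphim ?in_setT.
Qed.

End Decomposition.

Theorem theorem3p1 (k : nat) (hk : k \in [:: 3; 4; 5; 6]) :
  Cgroup (G2 k) (red_r k) /\
  exists act : groupAction 'Alt_('I_5) [set: 'rV['Z_2]_4],
    G2 k \isog [set: sdprod_by act].
Proof.
split; first exact: Cgroup_G2.
apply: sdprod_isog_sdprod_by (G2_sdprod k) (translations_isog k) _.
exact: icosahedral_isog_Alt (allP graph_okP _ (rho_bits_cases k)).
Qed.
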